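(* Let $\{a_n\}_{n\ge1}$ and $\{b_n\}_{n\ge1}$ be the sequences defined by $a_1=\frac{3}{16}$, $b_1=\frac{9}{16}$, and for $n>1$ $$a_n=\tfrac12 a_{n-1}+\tfrac{3}{16}b_{n-1},\qquad b_n=\tfrac12 a_{n-1}+\tfrac{9}{16}b_{n-1}.$$ For $n\ge 1$ let $P_n$ be the path with vertex set $\{v_0,\ldots,v_n\}$ and edge set $\{v_{i-1}v_i: i=1,\ldots,n\}$, and let $S_n$ be the star with vertex set $\{w_0,\ldots,w_n\}$ and edge set $\{w_{i-1}w_n: i=1,\ldots,n\}$ (so $w_n$ is its center). Then for every $n\geq 1$: In $P_n$, the end vertex $v_n$ satisfies $v_n^{0}=a_n$ and $v_n^{01}=b_n$; moreover $q(P_n)=2a_n+b_n$ and $b_n\geq\left(\frac{9}{16}\right)^n$. In $S_n$, the center $w_n$ satisfies $w_n^{01}=\left(\frac{9}{16}\right)^n$, and $$q(S_n)=2\left(\tfrac34\right)^n-\left(\tfrac34\right)^{2n}.$$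
   Context: For a finite simple graph $G=(V,E)$, associate a variable $x_v$ over $\mathbb{F}_2$ with each vertex $v$. A randomly generated system on $G$ has, for each edge $vw\in E$, one equation $f_{vw}(x_v,x_w)=0$, where the $f_{vw}$ are chosen independently and uniformly at random among all $16$ Boolean polynomials over $\mathbb{F}_2$ in the two variables $x_v,x_w$ (equivalently, all functions $\mathbb{F}_2^2\to\mathbb{F}_2$). $q(G)$ denotes the probability that this system is consistent, i.e. has a solution in $\mathbb{F}_2^{V}$. For a vertex $v$ of $G$: $v^{0}$ is the probability that the system is consistent and $x_v=0$ in all its solutions; $v^{1}$ is the probability that it is consistent and $x_v=1$ in all its solutions; $v^{01}$ is the probability that it has both a solution with $x_v=0$ and a solution with $x_v=1$. *)

(* Defs.v *)
From HB Require Import structures.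
From mathcomp Require Import all_boot all_order all_algebra.

Set Implicit Arguments.
Unset Strict Implicit.
Unset Printing Implicit Defensive.

Import Order.TTheory GRing.Theory Num.Theory.
Local Open Scope ring_scope.

Record sgraph := SGraph {
  vertex :> finType;
  adj : rel vertex;
  adj_sym : symmetric adj;
  adj_irr : irreflexive adj }.

(* Each undirected edge is listed exactly once, as the pair of its endpoints in
   the order of the canonical enumeration of the vertices. This only fixes
   which endpoint is the first argument of the function attached to the edge. *)
Definition edge (G : sgraph) : finType :=
  {p : G * G | adj p.1 p.2 && (enum_rank p.1 < enum_rank p.2)%N}.

(* Boolean polynomials in two variables, identified with the 16 functions
   F_2^2 -> F_2. *)
Definition bpoly2 : finType := {ffun 'F_2 * 'F_2 -> 'F_2}.

Definition system (G : sgraph) : finType := {ffun edge G -> bpoly2}.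

Definition assignment (G : sgraph) : finType := {ffun G -> 'F_2}.

Definition solves (G : sgraph) (F : system G) (x : assignment G) : bool :=
  [forall e : edge G, F e (x (val e).1, x (val e).2) == 0].

Definition consistent (G : sgraph) (F : system G) : bool :=
  [exists x : assignment G, solves F x].

(* The product of the uniform laws: the equations are independent, each being
   uniform on bpoly2. *)
Definition prob (G : sgraph) (A : pred (system G)) : rat :=
  \sum_(F : system G | A F) \prod_(e : edge G) #|bpoly2|%:R^-1.

Definition q (G : sgraph) : rat := prob (@consistent G).

(* p_forced v 0 is v^0 and p_forced v 1 is v^1. *)
Definition p_forced (G : sgraph) (v : G) (c : 'F_2) : rat :=
  prob (fun F : system G =>
    consistent F && [forall x : assignment G, solves F x ==> (x v == c)]).

(* v^01 *)
Definition p_free (G : sgraph) (v : G) : rat :=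
  prob (fun F : system G =>
    [exists x : assignment G, solves F x && (x v == 0)] &&
    [exists x : assignment G, solves F x && (x v == 1)]).

Definition path_adj (n : nat) : rel 'I_n.+1 :=
  fun i j => (j == i.+1 :> nat) || (i == j.+1 :> nat).

Lemma path_adj_sym n : symmetric (@path_adj n).
Proof. by move=> i j; rewrite /path_adj orbC. Qed.

Lemma path_adj_irr n : irreflexive (@path_adj n).
Proof. by move=> i; rewrite /path_adj orbb ltn_eqF. Qed.

Definition path_graph (n : nat) : sgraph :=
  SGraph (@path_adj_sym n) (@path_adj_irr n).

Definition star_adj (n : nat) : rel 'I_n.+1 :=
  fun i j => ((i < n)%N && (j == n :> nat)) || ((j < n)%N && (i == n :> nat)).

Lemma star_adj_sym n : symmetric (@star_adj n).
Proof. by move=> i j; rewrite /star_adj orbC. Qed.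

Lemma star_adj_irr n : irreflexive (@star_adj n).
Proof. by move=> i; rewrite /star_adj orbb; case: ltngtP. Qed.

Definition star_graph (n : nat) : sgraph :=
  SGraph (@star_adj_sym n) (@star_adj_irr n).

(* Main.v *)
(* Along the path, the set of values that the solutions of the first k equations
   allow at v_k is a Markov chain driven by the independent edge equations.
   Let u_k be the probability that a given value is allowed at v_k, and b_k that
   both are; averaging over the 16 equations on the last edge gives
   u_(k+1) = u_k - b_k / 4 and b_(k+1) = u_k / 2 + b_k / 16, which is the stated
   recursion for u = a + b. In the star, once the value of the center is fixed,
   the edges impose independent conditions: a random equation f(x, y) = 0 is
   solvable in x for a given y with probability 3/4, and for both values of y
   with probability 9/16. In both cases q follows by inclusion-exclusion on the
   value at the distinguished vertex. *)

Require Import Defs.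
From HB Require Import structures.
From mathcomp Require Import all_boot all_order all_algebra.
From mathcomp Require Import ring lra zify.

Set Implicit Arguments.
Unset Strict Implicit.
Unset Printing Implicit Defensive.

Import Order.TTheory GRing.Theory Num.Theory.
Local Open Scope ring_scope.

(** * Sums over the 16 equations of one edge *)

Lemma F2P (c : 'F_2) : c = 0 \/ c = 1.
Proof. by case: c => [[|[|//]] h]; [left | right]; apply: val_inj. Qed.

Lemma exists_F2 (P : pred 'F_2) : [exists c, P c] = P 0 || P 1.
Proof.
apply/existsP/orP=> [[c]|[] h]; [|by exists 0|by exists 1].
by case: (F2P c) => ->; [left | right].
Qed.

(** An element of [bpoly2] is determined by its zero set, an arbitrary subset of the four points.
    Averages over a random equation thus become explicit Boolean sums. *)
Lemma sum_bpoly2 (g : bool -> bool -> bool -> bool -> rat) :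
  \sum_(f : bpoly2)
    g (f (0, 0) == 0) (f (0, 1) == 0) (f (1, 0) == 0) (f (1, 1) == 0) =
  \sum_a \sum_b \sum_c \sum_d g a b c d.
Proof.
(* [true] marks a zero of the function, hence the negation in the table. *)
pose mk (z : bool * bool * (bool * bool)) : bpoly2 :=
  [ffun p : 'F_2 * 'F_2 =>
     let r := if p.1 == 0 then z.1 else z.2 in
     (~~ (if p.2 == 0 then r.1 else r.2))%:R].
pose zs (f : bpoly2) :=
  ((f (0, 0) == 0, f (0, 1) == 0), (f (1, 0) == 0, f (1, 1) == 0)).
have mkK : cancel mk zs.
  by case=> [[[] []] [[] []]]; rewrite /zs !ffunE /=.
have zsK : cancel zs mk.
  move=> f; apply/ffunP=> [[u v]]; rewrite /mk ffunE /=.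
  have nz (c : 'F_2) : (c != 0)%:R = c by case: (F2P c) => ->.
  by case: (F2P u) => ->; case: (F2P v) => -> /=; rewrite nz.
rewrite (reindex mk) /=; last by exists zs => ? _.
under eq_bigr => z _.
  have /(congr1 (fun z => g z.1.1 z.1.2 z.2.1 z.2.2)) := mkK z; rewrite /= => ->.
  over.
rewrite -(pair_bigA _ (fun p r : bool * bool => g p.1 p.2 r.1 r.2)) /=.
rewrite -(pair_bigA _ (fun a b => \sum_r g a b r.1 r.2)) /=.
apply: eq_bigr => a _; apply: eq_bigr => b _.
by rewrite -(pair_bigA _ (fun c d => g a b c d)).
Qed.

(** * Lists of independent uniform equations *)

(* The probability of [A] for a list of [n] independent uniform equations. *)
Definition pr (n : nat) (A : pred (seq bpoly2)) : rat :=
  \sum_(t : n.-tuple bpoly2) (A t)%:R / 16 ^+ n.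

Lemma pr0 (A : pred (seq bpoly2)) : pr 0 A = (A [::])%:R.
Proof.
rewrite /pr (big_pred1 [tuple]) => [|t]; first by rewrite divr1.
by apply/esym/eqP; exact: tuple0.
Qed.

Lemma prS n (A : pred (seq bpoly2)) :
  pr n.+1 A =
  \sum_(t : n.-tuple bpoly2) (\sum_(f : bpoly2) (A (f :: t))%:R / 16) / 16 ^+ n.
Proof.
rewrite /pr (reindex (fun p : bpoly2 * n.-tuple bpoly2 => [tuple of p.1 :: p.2])) /=.
  rewrite -(pair_bigA _ (fun f t => (A (f :: tval t))%:R / 16 ^+ n.+1)) /=.
  rewrite exchange_big; apply: eq_bigr => t _; rewrite mulr_suml.
  by apply: eq_bigr => f _; rewrite exprSr invfM mulrA mulrAC.
exists (fun t => (thead t, [tuple of behead t])) => [[f t] _|t _] /=.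
  by congr pair; apply: val_inj.
by rewrite [RHS]tuple_eta.
Qed.

Lemma pr_all n (P : pred bpoly2) :
  pr n (all P) = (\sum_(f : bpoly2) (P f)%:R / 16) ^+ n.
Proof.
elim: n => [|n IH]; first by rewrite pr0.
rewrite prS exprS -IH mulr_sumr; apply: eq_bigr => t _; rewrite mulrA; congr (_ / _).
by rewrite mulr_suml; apply: eq_bigr => f _ /=; rewrite -mulnb natrM mulrAC.
Qed.

(** * Events on a general graph *)

Section System.
Variable G : sgraph.

Lemma eq_prob (A B : pred (system G)) : A =1 B -> prob A = prob B.
Proof. exact: eq_bigl. Qed.

Lemma probE (A : pred (system G)) :
  prob A = \sum_(F : system G) (A F)%:R * \prod_(e : edge G) #|bpoly2|%:R^-1.
Proof.
by rewrite /prob big_mkcond; apply: eq_bigr => F _; rewrite mulr_natl mulrb.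
Qed.

(** Enumerating the edges carries the product law on systems to that on tuples, where induction on
    the number of equations is available. *)
Lemma prob_pr n (h : 'I_n -> edge G) (A : pred (system G)) (B : pred (seq bpoly2)) :
  bijective h -> (forall F, A F = B [tuple F (h i) | i < n]) -> prob A = pr n B.
Proof.
move=> bh AB; have [k hK kK] := bh.
rewrite /prob /pr (reindex (fun t : n.-tuple bpoly2 => [ffun e => tnth t (k e)])) /=; last first.
  exists (fun F : system G => [tuple F (h i) | i < n]) => [t _|F _].
    by apply: eq_from_tnth => i; rewrite tnth_mktuple ffunE hK.
  by apply/ffunP=> e; rewrite ffunE tnth_mktuple kK.
rewrite big_mkcond; apply: eq_bigr => t _; rewrite AB.
have -> : [tuple [ffun e => tnth t (k e)] (h i) | i < n] = t.
  by apply: eq_from_tnth => i; rewrite tnth_mktuple ffunE hK.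
case: (B t); last by rewrite mul0r.
rewrite prodr_const mul1r -exprVn -(bij_eq_card bh) card_ord.
by rewrite card_ffun card_prod !card_Fp.
Qed.

Lemma solves_bij n (h : 'I_n -> edge G) (F : system G) (x : assignment G) :
  bijective h ->
  solves F x = [forall i, F (h i) (x (val (h i)).1, x (val (h i)).2) == 0].
Proof.
case=> k hK kK.
by apply/forallP/forallP=> [sx i|sx e]; [apply: (sx (h i)) | rewrite -(kK e)].
Qed.

Definition attains (F : system G) (v : G) (c : 'F_2) : bool :=
  [exists x : assignment G, solves F x && (x v == c)].

Variable v : G.

Lemma consistent_attains F : consistent F = attains F v 0 || attains F v 1.
Proof.
rewrite -(exists_F2 (attains F v)); apply/existsP/existsP => [[x sx]|[c]].
  by exists (x v); apply/existsP; exists x; rewrite sx eqxx.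
by case/existsP=> x /andP[sx _]; exists x.
Qed.

(** Being forced to 0 means that 0 is attained and 1 is not. *)
Lemma p_forced0E : p_forced v 0 = prob (fun F => attains F v 0) - p_free v.
Proof.
rewrite /p_forced /p_free !probE -sumrB.
apply: eq_bigr => F _; rewrite -!/(attains F v _) -mulrBl; congr (_ * _).
have -> : [forall x : assignment G, solves F x ==> (x v == 0)] = ~~ attains F v 1.
  rewrite negb_exists; apply: eq_forallb => x; rewrite negb_and implybE.
  by case: (F2P (x v)) => ->.
rewrite consistent_attains.
by case: (attains F v 0); case: (attains F v 1); rewrite /= ?subr0 ?subrr.
Qed.

Lemma probU (A B : pred (system G)) :
  prob (fun F => A F || B F) = prob A + prob B - prob (fun F => A F && B F).
Proof.
rewrite !probE -big_split -sumrB; apply: eq_bigr => F _ /=.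
by case: (A F); case: (B F) => /=; ring.
Qed.

Lemma qE :
  q G = prob (fun F => attains F v 0) + prob (fun F => attains F v 1) - p_free v.
Proof. by rewrite -probU; apply: eq_prob => F; exact: consistent_attains. Qed.

End System.

(** * Averages over one random equation *)

Lemma sum_attainable (c : 'F_2) :
  \sum_(f : bpoly2) [exists u, f (u, c) == 0]%:R / 16 = 3 / 4 :> rat.
Proof.
under eq_bigr do rewrite exists_F2.
case: (F2P c) => ->.
  by rewrite (sum_bpoly2 (fun a _ c _ => (a || c)%:R / 16)) !big_bool /=; field.
by rewrite (sum_bpoly2 (fun _ b _ d => (b || d)%:R / 16)) !big_bool /=; field.
Qed.

Lemma sum_attainable_both :
  \sum_(f : bpoly2)
    ([exists u, f (u, 0) == 0] && [exists u, f (u, 1) == 0])%:R / 16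
  = 9 / 16 :> rat.
Proof.
under eq_bigr do rewrite !exists_F2.
rewrite (sum_bpoly2 (fun a b c d => ((a || c) && (b || d))%:R / 16)).
by rewrite !big_bool /=; field.
Qed.

(* Whether [c] is a possible value at the end of a path whose edges, listed
   starting from that end, carry the equations [s]. *)
Fixpoint reach (s : seq bpoly2) (c : 'F_2) : bool :=
  if s is f :: s' then [exists u, reach s' u && (f (u, c) == 0)] else true.

(** The conditional probability is 0, 1/2 or 3/4 when 0, 1 or 2 values are reachable before the new
    edge; the right side encodes the three cases through indicators. *)
Lemma sum_reach (s : seq bpoly2) (c : 'F_2) :
  \sum_(f : bpoly2) (reach (f :: s) c)%:R / 16 =
  ((reach s 0)%:R + (reach s 1)%:R) / 2 - (reach s 0 && reach s 1)%:R / 4 :> rat.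
Proof.
under eq_bigr do rewrite /= exists_F2.
case: (F2P c) => ->.
  rewrite (sum_bpoly2 (fun x _ y _ => (reach s 0 && x || reach s 1 && y)%:R / 16)).
  by rewrite !big_bool; case: (reach s 0); case: (reach s 1) => /=; field.
rewrite (sum_bpoly2 (fun _ x _ y => (reach s 0 && x || reach s 1 && y)%:R / 16)).
by rewrite !big_bool; case: (reach s 0); case: (reach s 1) => /=; field.
Qed.

(** Here the three cases give 0, 1/4 and 9/16. *)
Lemma sum_reach_both (s : seq bpoly2) :
  \sum_(f : bpoly2) (reach (f :: s) 0 && reach (f :: s) 1)%:R / 16 =
  ((reach s 0)%:R + (reach s 1)%:R) / 4 + (reach s 0 && reach s 1)%:R / 16 :> rat.
Proof.
under eq_bigr do rewrite /= !exists_F2.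
rewrite (sum_bpoly2 (fun x y z w =>
  ((reach s 0 && x || reach s 1 && z) && (reach s 0 && y || reach s 1 && w))%:R / 16)).
by rewrite !big_bool; case: (reach s 0); case: (reach s 1) => /=; field.
Qed.

Lemma pr_reachS n c :
  pr n.+1 (reach^~ c) =
  (pr n (reach^~ 0) + pr n (reach^~ 1)) / 2
  - pr n (fun s => reach s 0 && reach s 1) / 4.
Proof.
rewrite prS /pr -big_split !mulr_suml -sumrB; apply: eq_bigr => t _ /=.
by rewrite sum_reach /=; field; exact: expf_neq0.
Qed.

Lemma pr_reach_bothS n :
  pr n.+1 (fun s => reach s 0 && reach s 1) =
  (pr n (reach^~ 0) + pr n (reach^~ 1)) / 4
  + pr n (fun s => reach s 0 && reach s 1) / 16.
Proof.
rewrite prS /pr -big_split !mulr_suml -big_split; apply: eq_bigr => t _ /=.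
by rewrite sum_reach_both; field; exact: expf_neq0.
Qed.

(** Unfolds the recursion into a whole assignment, indexed by the distance to the end vertex: [y 0]
    is the value there. *)
Lemma reachP (s : seq bpoly2) (c : 'F_2) :
  reflect (exists2 y : nat -> 'F_2, y 0%N = c &
             forall i, (i < size s)%N -> nth 0 s i (y i.+1, y i) = 0)
          (reach s c).
Proof.
apply: (iffP idP).
  elim: s c => [|f s IH] c /=; first by exists (fun _ => c).
  case/existsP=> u /andP[/IH[y y0 ys] /eqP fu].
  exists (fun k => if k is k'.+1 then y k' else c) => // -[|i] /=; first by rewrite y0.
  exact: ys.
elim: s c => [//|f s IH] c [y y0 ys] /=; apply/existsP; exists (y 1%N).
rewrite -y0 (ys 0%N) // eqxx andbT; apply: IH.
by exists (fun k => y k.+1) => // i; apply: (ys i.+1).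
Qed.

(** * Paths *)

Section Path.
Variable n : nat.

(* The edges of the path listed backwards from [v_n]: edge [i] joins
   [v_(n - i - 1)] to [v_(n - i)]. *)
Definition path_ends (i : 'I_n) : path_graph n * path_graph n :=
  (rev_ord (lift ord0 i), rev_ord (widen_ord (leqnSn n) i)).

Lemma path_ends_edge i :
  adj (path_ends i).1 (path_ends i).2 &&
  (enum_rank (path_ends i).1 < enum_rank (path_ends i).2)%N.
Proof.
have := ltn_ord i.
rewrite !enum_rank_ord /= /path_adj /= !subSS /bump /= => ?; lia.
Qed.

Definition path_edge (i : 'I_n) : edge (path_graph n) := Sub (path_ends i) (path_ends_edge i).

(** Ordinals are enumerated in increasing order, so each edge points towards [v_n]. *)
Lemma path_edge_succ (e : edge (path_graph n)) :
  (val e).2 = (val e).1.+1 :> nat.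
Proof.
by case: e => -[u w] /= h; move: h; rewrite !enum_rank_ord /= /path_adj; lia.
Qed.

Lemma path_edge_bij : bijective path_edge.
Proof.
pose k (e : edge (path_graph n)) : nat := (n - (val e).2)%N.
have kn e : (k e < n)%N.
  by rewrite /k; have := path_edge_succ e; have := ltn_ord (val e).2; lia.
exists (fun e => Ordinal (kn e)) => [i|e].
  by apply: val_inj; rewrite /= /k /= subSS; have := ltn_ord i; lia.
apply: val_inj; rewrite [RHS]surjective_pairing.
have := path_edge_succ e; have := ltn_ord (val e).2 => /= ? ?.
by congr pair; apply: ord_inj; rewrite /= /k ?subSS /bump /=; lia.
Qed.

Lemma attains_path (F : system (path_graph n)) c :
  attains F (ord_max : path_graph n) c = reach [tuple F (path_edge i) | i < n] c.
Proof.
apply/existsP/reachP => [[x]|[y y0 ys]].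
  rewrite (solves_bij F _ path_edge_bij) => /andP[/forallP sx /eqP xc].
  (* The vertex at distance [k] from the end is [v_(n - k)]. *)
  exists (fun k => x (inord (n - k)%N)).
    by rewrite -xc; congr (x _); apply: ord_inj; rewrite inordK ?subn0.
  rewrite size_tuple => i lt_in.
  rewrite -[i]/(nat_of_ord (Ordinal lt_in)) -tnth_nth tnth_mktuple.
  set o := Ordinal lt_in.
  have -> : inord (n - i.+1) = (path_ends o).1.
    by apply: ord_inj; rewrite inordK /= ?subSS /bump //=; lia.
  have -> : inord (n - i) = (path_ends o).2.
    by apply: ord_inj; rewrite inordK /= ?subSS //=; lia.
  exact/eqP/sx.
exists [ffun v : 'I_n.+1 => y (n - v)%N : 'F_2].
rewrite (solves_bij F _ path_edge_bij) ffunE subnn y0 eqxx andbT; apply/forallP => i.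
have := ys i; rewrite size_tuple ltn_ord -tnth_nth tnth_mktuple => /(_ isT) <-.
by rewrite !ffunE /= !subSS !subKn // ltnW.
Qed.

End Path.

(** * Stars *)

Section Star.
Variable n : nat.

Definition star_ends (i : 'I_n) : star_graph n * star_graph n :=
  (widen_ord (leqnSn n) i, ord_max).

Lemma star_ends_edge i :
  adj (star_ends i).1 (star_ends i).2 &&
  (enum_rank (star_ends i).1 < enum_rank (star_ends i).2)%N.
Proof. by rewrite !enum_rank_ord /= /star_adj /= ltn_ord eqxx. Qed.

Definition star_edge (i : 'I_n) : edge (star_graph n) :=
  Sub (star_ends i) (star_ends_edge i).

(** The center has the largest index, so it is always the second endpoint. *)
Lemma star_edgeP (e : edge (star_graph n)) :
  ((val e).1 < n)%N /\ (val e).2 = n :> nat.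
Proof.
case: e => -[u w] /= h; move: h.
by rewrite !enum_rank_ord /= /star_adj; have := ltn_ord w; lia.
Qed.

Lemma star_edge_bij : bijective star_edge.
Proof.
exists (fun e => Ordinal (star_edgeP e).1) => [i|e]; first exact: val_inj.
apply: val_inj; rewrite [RHS]surjective_pairing.
by congr pair; apply: ord_inj => //=; rewrite (star_edgeP e).2.
Qed.

Lemma attains_star (F : system (star_graph n)) c :
  attains F (ord_max : star_graph n) c =
  all (fun f : bpoly2 => [exists u, f (u, c) == 0]) [tuple F (star_edge i) | i < n].
Proof.
apply/existsP/all_tnthP => [[x] + i|sF].
  rewrite (solves_bij F _ star_edge_bij) tnth_mktuple => /andP[/forallP/(_ i) sx /eqP xc].
  by apply/existsP; exists (x (star_ends i).1); rewrite -xc.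
have {}sF i : exists u, F (star_edge i) (u, c) == 0.
  by have /existsP := sF i; rewrite tnth_mktuple.
pose y i := xchoose (sF i).
(* Each leaf takes its own witness; [insub] fails only at the center, which gets [c]. *)
exists [ffun w : 'I_n.+1 => if insub (val w) is Some i then y i else c].
rewrite (solves_bij F _ star_edge_bij) ffunE insubF ?ltnn // eqxx andbT; apply/forallP => i.
by rewrite !ffunE /= valK; apply: xchooseP (sF i).
Qed.

Lemma prob_attains_star c :
  prob (fun F : system (star_graph n) => attains F (ord_max : star_graph n) c) =
  (3 / 4) ^+ n.
Proof.
rewrite -(sum_attainable c) -pr_all; apply: (prob_pr star_edge_bij) => F.
exact: attains_star.
Qed.

(** Both values are attained at the center iff every edge allows both, since the leaves are chosen
    separately; independence gives a power. *)
Lemma p_free_star : p_free (ord_max : star_graph n) = (9 / 16) ^+ n.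
Proof.
rewrite -sum_attainable_both -pr_all; apply: (prob_pr star_edge_bij) => F.
by rewrite -!/(attains F _ _) !attains_star -all_predI.
Qed.

End Star.

(** * The recursion and the final formulas *)

Theorem lemma12 (a b : nat -> rat)
  (a1 : a 1%N = 3 / 16)
  (b1 : b 1%N = 9 / 16)
  (aS : forall n : nat, (1 < n)%N ->
     a n = 1 / 2 * a n.-1 + 3 / 16 * b n.-1)
  (bS : forall n : nat, (1 < n)%N ->
     b n = 1 / 2 * a n.-1 + 9 / 16 * b n.-1)
  (n : nat) (hn : (1 <= n)%N) :
  [/\ p_forced (ord_max : path_graph n) 0 = a n,
      p_free (ord_max : path_graph n) = b n,
      q (path_graph n) = 2 * a n + b n
    & (9 / 16) ^+ n <= b n] /\
  (p_free (ord_max : star_graph n) = (9 / 16) ^+ n /\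
   q (star_graph n) = 2 * (3 / 4) ^+ n - (3 / 4) ^+ (2 * n)).
Proof.
have aSS m : a m.+2 = 1 / 2 * a m.+1 + 3 / 16 * b m.+1 by exact: aS.
have bSS m : b m.+2 = 1 / 2 * a m.+1 + 9 / 16 * b m.+1 by exact: bS.
have reachE m : (0 < m)%N ->
    (forall c, pr m (reach^~ c) = a m + b m) /\
    pr m (fun s => reach s 0 && reach s 1) = b m.
  elim: m => [//|[|m] IH] _.
    (* With no edge both values are allowed, so the first step gives 1 - 1/4 = 3/16 + 9/16 and 1/2 +
       1/16 = 9/16. *)
    by split=> [c|]; rewrite ?pr_reachS ?pr_reach_bothS !pr0 /= ?a1 b1; lra.
  have [pc pb] := IH isT.
  split=> [c|]; first by rewrite pr_reachS !pc pb aSS bSS; lra.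
  by rewrite pr_reach_bothS !pc pb bSS; lra.
(* The two bounds go together: [0 <= a m] gives the growth of [b] by 9/16, and the bound on [b]
   keeps [a] nonnegative. *)
have ab m : (0 < m)%N -> 0 <= a m /\ (9 / 16) ^+ m <= b m.
  elim: m => [//|[|m] IH] _; first by rewrite a1 b1 expr1; split; lra.
  have [a0 bm] := IH isT; rewrite aSS bSS exprS.
  have : 0 <= (9 / 16 : rat) ^+ m.+1 by apply: exprn_ge0; lra.
  by split; lra.
have [pc pb] := reachE n hn; have [_ bn] := ab n hn.
have at_path c :
    prob (fun F => attains F (ord_max : path_graph n) c) = a n + b n.
  by rewrite -(pc c); apply: (prob_pr (path_edge_bij n)) => F; apply: attains_path.
have free_path : p_free (ord_max : path_graph n) = b n.
  rewrite -pb; apply: (prob_pr (path_edge_bij n)) => F.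
  by rewrite -!/(attains F _ _) !attains_path.
split; first split.
- by rewrite p_forced0E at_path free_path addrK.
- exact: free_path.
- by rewrite (qE (ord_max : path_graph n)) !at_path free_path; ring.
- exact: bn.
split; first exact: p_free_star.
(* The subtracted term matches because 9/16 is the square of 3/4. *)
rewrite (qE (ord_max : star_graph n)) !prob_attains_star p_free_star exprM.
by rewrite mulrDl !mul1r; congr (_ - _ ^+ _); field.
Qed.
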